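(* Let $\Gamma$ be a numerical semigroup with $\Gamma\ne\mathbb{N}$. (1) There exist an integer $N_0$ and a finite set of corner indices $I$ (both depending only on $\Gamma$) such that for all $N\ge N_0$, the global optimum $w^*$ for the Unsimplified Problem for $\Gamma$ lies on the face of $W$ corresponding to $I$, and on no smaller face. (2) Write $\ell=\max I$. For all $N\ge N_0$, the coordinates $w_0^*,\dots,w_{\ell-1}^*$ are constant with respect to $N$, and the coordinates $w_\ell^*,\dots,w_N^*$ are given by $w_i^*=mi+b$, where $$m=\frac{-6}{(N-\ell+1)(N-\ell+2)},\qquad b=2+\frac{2(N+2\ell-1)}{(N-\ell+1)(N-\ell+2)}.$$
   Context: Semigroup. $\mathbb{N}=\{0,1,2,\dots\}$; a numerical semigroup is a submonoid $\Gamma\subset\mathbb{N}$ with finite complement, with elements $0=\gamma_0<\gamma_1<\cdots$. $\operatorname{cond}(\Gamma)$ is the least integer $c$ with $\{n\in\mathbb{N}:n\ge c\}\subset\Gamma$, and $\operatorname{c.i.}(\Gamma)$ is the index with $\gamma_{\operatorname{c.i.}(\Gamma)}=\operatorname{cond}(\Gamma)$. $N>\operatorname{c.i.}(\Gamma)$ is an integer (the embedding dimension). Unsimplified Problem. $W=W_N\subset\mathbb{R}^{N+1}$ is the cone of $w=(w_0,\dots,w_N)$ with $\frac{w_i-w_{i-1}}{\gamma_i-\gamma_{i-1}}\le\frac{w_{i+1}-w_i}{\gamma_{i+1}-\gamma_i}$ for $1\le i\le N-1$. Let $a=(a_1,\dots,a_{N+1})$ with $a_1=\gamma_1$, $a_i=\gamma_i-\gamma_{i-2}$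 for $2\le i\le N$, and $a_{N+1}=1$. The global optimum of the Unsimplified Problem is the unique $w^*\in W$ minimizing $\sum_{i=0}^N(w_i-a_{i+1})^2$. Faces. A set of corner indices $I\subset\{1,\dots,N-1\}$ corresponds to the face of $W$ consisting of those $w\in W$ for which the $i$-th inequality above is an equality for all $i\in\{1,\dots,N-1\}\setminus I$. So $w^*$ lies on this face and on no smaller one exactly when the set of $i$ at which the $i$-th inequality is strict for $w^*$ equals $I$. *)

(* Defs.v *)
From HB Require Import structures.
From mathcomp Require Import all_boot all_order all_algebra finmap.
From mathcomp Require Import all_classical all_reals all_analysis.
From mathcomp Require Import ring lra zify.
Set Implicit Arguments.
Unset Strict Implicit.
Unset Printing Implicit Defensive.
Import Order.TTheory GRing.Theory Num.Theory.
Import numFieldNormedType.Exports.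

Local Open Scope classical_set_scope.
Local Open Scope ring_scope.

Record numerical_semigroup := NumericalSemigroup {
  carrier :> set nat;
  carrier0 : carrier 0%N;
  carrierD : forall m n : nat, carrier m -> carrier n -> carrier (m + n)%N;
  carrier_cofinite : finite_set (~` carrier) }.

Section Semigroup.
Variable G : numerical_semigroup.
Implicit Types m n c i j : nat.

Lemma cond_exists : exists c, `[< forall n, (c <= n)%N -> carrier G n >].
Proof.
have /finite_seqP[s sE] := carrier_cofinite G.
exists (\max_(i <- s) i).+1; apply/asboolP => n ltn; apply: contrapT => nG.
have ns : n \in s by have : (~` carrier G) n by []; rewrite sE.
by move: ltn; rewrite ltnNge leq_bigmax_seq.
Qed.

Definition cond : nat := ex_minn cond_exists.

Lemma condP n : (cond <= n)%N -> carrier G n.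
Proof. by rewrite /cond; case: ex_minnP => c /asboolP + _; apply. Qed.

Lemma succ_in_exists m : exists n, (m < n)%N && `[< carrier G n >].
Proof.
exists (maxn m.+1 cond); rewrite leq_maxl /=; apply/asboolP/condP.
exact: leq_maxr.
Qed.

Definition succ_in m : nat := ex_minn (succ_in_exists m).

(* gamma i is the (i+1)-st smallest element of G, so gamma 0 = 0. *)
Definition gamma i : nat := iter i succ_in 0%N.

Lemma gamma_in i : carrier G (gamma i).
Proof.
case: i => [|i]; first exact: carrier0.
by rewrite /gamma /= /succ_in; case: ex_minnP => n /andP[_ /asboolP].
Qed.

Lemma gamma_ltS i : (gamma i < gamma i.+1)%N.
Proof. by rewrite {2}/gamma /= /succ_in; case: ex_minnP => n /andP[]. Qed.

Lemma gamma_lt : {homo gamma : i j / (i < j)%N}.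
Proof. by apply: homo_ltn => [? ? ?|]; [exact: ltn_trans | exact: gamma_ltS]. Qed.

Lemma gamma_surj n : carrier G n -> exists i, gamma i = n.
Proof.
move=> Gn.
have gei i : (i <= gamma i)%N.
  by elim: i => // i IH; exact: leq_ltn_trans IH (gamma_ltS i).
have exi : exists i, (n <= gamma i)%N by exists n.
case: (ex_minnP exi) => -[|i] ni imin.
  by exists 0%N; apply/eqP; rewrite eqn_leq ni andbT.
exists i.+1; apply/eqP; rewrite eqn_leq ni andbT.
have lt_in : (gamma i < n)%N.
  by rewrite ltnNge; apply/negP => /imin; rewrite ltnn.
rewrite /gamma /= /succ_in; case: ex_minnP => k _; apply.
by rewrite -/(gamma i) lt_in; exact/asboolP.
Qed.

Lemma range_gamma : range gamma = carrier G.
Proof.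
apply/seteqP; split=> [_ [i _ <-]|n /gamma_surj[i <-]]; first exact: gamma_in.
by exists i.
Qed.

Lemma ci_exists : exists i, gamma i == cond.
Proof. by have [i <-] := gamma_surj (condP (leqnn cond)); exists i. Qed.

Definition ci : nat := ex_minn ci_exists.

Lemma gamma_ci : gamma ci = cond.
Proof. by rewrite /ci; case: ex_minnP => i /eqP. Qed.

End Semigroup.

Section UnsimplifiedProblem.
Variables (R : realType) (G : numerical_semigroup) (N : nat).
Implicit Types (w v : 'rV[R]_N.+1) (i : nat) (I : {fset nat}).

(* Only meaningful for i <= N. *)
Definition entry w i : R := w ord0 (inord i).

Definition slope w i : R :=
  (entry w i - entry w i.-1) / ((gamma G i)%:R - (gamma G i.-1)%:R).

Definition coneW : set 'rV[R]_N.+1 :=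
  [set w | forall i, (1 <= i <= N - 1)%N -> slope w i <= slope w i.+1].

(* Indexed from 1: target i is meant for 1 <= i <= N + 1. *)
Definition target i : R :=
  if i == N.+1 then 1
  else if i == 1%N then (gamma G 1)%:R
  else (gamma G i)%:R - (gamma G (i - 2))%:R.

Definition cost w : R := \sum_(0 <= i < N.+1) (entry w i - target i.+1) ^+ 2.

Definition is_minimizer w : Prop := coneW w /\ forall v, coneW v -> cost w <= cost v.

(* The default 0 is never used: see global_optimumP. *)
Definition global_optimum : 'rV[R]_N.+1 := xget 0 [set w | is_minimizer w].

Definition face I : set 'rV[R]_N.+1 :=
  [set w | coneW w /\ forall i, (1 <= i <= N - 1)%N -> i \notin I ->
                  slope w i = slope w i.+1].

Definition minimal_face w I : Prop :=
  face I w /\ forall J, (J `<` I)%fset -> ~ face J w.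

Lemma minimal_faceP w I : coneW w ->
  (forall i, i \in I -> (1 <= i <= N - 1)%N) ->
  minimal_face w I <->
  (forall i, (1 <= i <= N - 1)%N -> (slope w i < slope w i.+1) = (i \in I)).
Proof.
move=> Ww Isub; split=> [[[_ Iw] minI] i hi|strictI].
  have [iI|/(Iw i hi) ->] := boolP (i \in I); last by rewrite ltxx.
  rewrite lt_neqAle Ww // andbT; apply/negP => /eqP eqi.
  apply: (minI (I `\ i)%fset); first by rewrite fproperD1.
  split=> // j hj; rewrite !inE negb_and negbK => /orP[/eqP -> //|].
  exact: Iw.
split.
  split=> // i hi iI; apply/eqP; rewrite eq_le Ww //=.
  by rewrite leNgt strictI.
move=> J /andP[_ /fsubsetPn[i iI iJ]] [_ Jw].
by have := strictI i (Isub i iI); rewrite iI (Jw i (Isub i iI) iJ) ltxx.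
Qed.

End UnsimplifiedProblem.

Arguments coneW {R} G N.
Arguments face {R} G N I.
Arguments minimal_face {R} G {N} w I.

Section Existence.
Variables (R : realType) (G : numerical_semigroup) (N : nat).
Implicit Types (w v : 'rV[R]_N.+1).

Lemma entry_cont i : continuous (fun w => entry w i).
Proof. exact: coord_continuous. Qed.

Lemma slope_cont i : continuous (fun w => slope G w i).
Proof.
move=> w; apply: (@continuousM _ _ (fun v => entry v i - entry v i.-1)
  (fun=> ((gamma G i)%:R - (gamma G i.-1)%:R)^-1)); last exact: cst_continuous.
by apply: (@continuousB _ _ _ (fun v => entry v i)); exact: entry_cont.
Qed.

Lemma cost_cont : continuous (@cost R G N).
Proof.
move=> w; rewrite /cost.
apply: cvg_big => [x||i _]; [exact: add_continuous|exact: (nbhs_filter w)|].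
apply: (@continuous_comp _ _ _ (fun v => entry v i - target R G N i.+1)
  (@GRing.exp R ^~ 2%N)); last exact: exprn_continuous.
apply: (@continuousB _ _ _ (fun v => entry v i)); first exact: entry_cont.
exact: cst_continuous.
Qed.

Lemma closed_W : closed (@coneW R G N).
Proof.
have -> : @coneW R G N = \bigcap_(i in [set i | (1 <= i <= N - 1)%N])
   ((fun w => slope G w i.+1 - slope G w i) @^-1` [set x | 0 <= x]).
  by apply/seteqP; split=> w Ww i /Ww /=; rewrite subr_ge0.
apply: closed_bigI => i _.
apply: preimage_closed; last exact: closed_ge.
by move=> w _; apply: (@continuousB _ _ _ (fun v => slope G v i.+1)); exact: slope_cont.
Qed.

Lemma W0 : coneW G N (0 : 'rV[R]_N.+1).
Proof.
by move=> i _; rewrite /slope /entry !mxE !subrr !mul0r.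
Qed.

Lemma slopeD w v i : slope G (w + v) i = slope G w i + slope G v i.
Proof. by rewrite /slope /entry !mxE -mulrDl; congr (_ / _); ring. Qed.

Lemma slopeZ (c : R) w i : slope G (c *: w) i = c * slope G w i.
Proof. by rewrite /slope /entry !mxE -mulrBr mulrA. Qed.

Lemma minimizer_exists : exists w, @is_minimizer R G N w.
Proof.
pose C : R := cost G (0 : 'rV[R]_N.+1).
have C0 : 0 <= C by apply: sumr_ge0 => i _; exact: sqr_ge0.
pose S : R := \sum_(0 <= i < N.+1) `|target R G N i.+1|.
pose B : R := S + C + 1.
pose box := [set w : 'rV[R]_N.+1 | forall i, w ord0 i \in `[- B, B]].
have S0 : 0 <= S by apply: sumr_ge0.
have cbox : compact box.
  by apply: (@rV_compact _ _ (fun=> `[- B, B]%classic)) => _; exact: segment_compact.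
have box0 : (box `&` coneW G N) 0.
  split; last exact: W0.
  by move=> i; rewrite mxE in_itv /= /B; apply/andP; split; lra.
have [||w] := @EVT_min_rV R N.+1 (@cost R G N) _ _ (compact_closedI cbox closed_W).
- by exists 0.
- exact/continuous_subspaceT/cost_cont.
rewrite inE => -[_ Ww] wmin; exists w; split=> // v Wv.
have [vbox|vbox] := pselect (box v); first by apply: wmin; rewrite inE.
apply: le_trans (_ : C <= _); first by apply: wmin; rewrite inE.
have [i vi] : exists i, ~ (v ord0 i \in `[- B, B]) by exact/existsNP.
rewrite /cost big_mkord (bigD1 i) //= ler_wpDr ?sumr_ge0 // => [j _|].
  exact: sqr_ge0.
have -> : entry v i = v ord0 i by rewrite /entry inord_val.
set t := target _ _ _ _.
have tS : `|t| <= S.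
  by rewrite /S big_mkord (bigD1 i) //= lerDl sumr_ge0.
have tl : - S <= t <= S by rewrite -ler_norml.
have : B < `|v ord0 i|.
  by rewrite ltNge ler_norml; apply/negP; move: vi; rewrite in_itv.
case/andP: tl; rewrite /B lter_normr => t1 t2 /orP[] h; nra.
Qed.

Lemma minimizer_unique w v :
  is_minimizer G w -> is_minimizer G v -> w = v.
Proof.
move=> [Ww wmin] [Wv vmin].
pose m := 2^-1 *: (w + v).
have Wm : coneW G N m.
  move=> i hi; rewrite !slopeZ !slopeD ler_pM2l ?invr_gt0 //.
  by apply: lerD; [exact: Ww | exact: Wv].
pose D := \sum_(0 <= i < N.+1) (entry w i - entry v i) ^+ 2.
have E : 4 * cost G m + D = 2 * cost G w + 2 * cost G v.
  rewrite /cost /D !mulr_sumr -!big_split /=; apply: eq_bigr => i _.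
  by rewrite /entry !mxE; field.
have D0 : D = 0.
  apply/eqP; rewrite eq_le; apply/andP; split.
    by have := wmin _ Wm; have := vmin _ Wm; lra.
  by apply: sumr_ge0 => i _; exact: sqr_ge0.
apply/rowP => i; apply/eqP; rewrite -subr_eq0 -sqrf_eq0.
move/eqP: D0; rewrite /D big_mkord psumr_eq0 => [/allP/(_ i)|j _].
  by rewrite mem_index_enum /entry inord_val => /(_ isT).
exact: sqr_ge0.
Qed.

Lemma global_optimumP :
  unique (@is_minimizer R G N) (global_optimum R G N).
Proof.
have [w Pw] := minimizer_exists.
have Pg : is_minimizer G (global_optimum R G N).
  by rewrite /global_optimum; exact: (@xgetI _ 0 [set w | is_minimizer G w] w).
by split=> // v Pv; exact: minimizer_unique.
Qed.

End Existence.

(* Main.v *)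
Require Import Defs.
From HB Require Import structures.
From mathcomp Require Import all_boot all_order all_algebra finmap.
From mathcomp Require Import all_classical all_reals all_analysis.
From mathcomp Require Import ring lra zify.
Set Implicit Arguments.
Unset Strict Implicit.
Unset Printing Implicit Defensive.
Import Order.TTheory GRing.Theory Num.Theory.
Import numFieldNormedType.Exports.
Local Open Scope classical_set_scope.
Local Open Scope ring_scope.

(* Write a_{i+1} = 2 + d_i: d >= 0 vanishes past ci. Let h be the projection of d onto the
   convex sequences vanishing from index M on. In the KKT conditions the second
   antiderivative of h - d is nonnegative, zero at the corners of h, convex past ci, and
   concave where h vanishes. For M large this forces h to vanish from some l < M with l
   > ci, the antiderivative being zero at both l - 1 and l. So the problem decouples at
   l: for every large N the optimum is 2 + h before l and the regression line of 2, ...,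
   2, 1 from l on, and the two pieces are glued convexly, with strict corners at l - 1
   and l because that line lies just above 2 near l and its slope tends to 0. *)

(** * Nonnegative least squares and its first order conditions *)

Lemma quadratic_ge0_slope (R : realFieldType) (a q e : R) :
  0 < e -> (forall t, 0 <= t <= e -> 0 <= 2 * t * a + t ^+ 2 * q) -> 0 <= a.
Proof.
move=> e0 H; rewrite leNgt; apply/negP => a0.
have q0 : 0 < `|q| + 1 by rewrite ltr_wpDl.
(* This [t] gives t^2 q <= - t a - t^2, so the quadratic is at most t a - t^2 < 0. *)
pose t := Num.min e (- a / (`|q| + 1)).
have t0 : 0 < t by rewrite lt_min e0 divr_gt0 // oppr_gt0.
have te : t <= e by rewrite ge_min lexx.
have ta : t * (`|q| + 1) <= - a by rewrite -ler_pdivlMr // ge_min lexx orbT.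
have /H : 0 <= t <= e by rewrite te ltW.
have := ler_norm q; nra.
Qed.

(** Minimize over a compact box with sides [0, B]. The bound B is never reached, so each coordinate
    can be moved up, and also down when it is positive; these variations give the first order
    conditions. *)
Lemma nonneg_least_squares (R : realType) (m n : nat) (A : 'M[R]_(m.+1, n))
    (d : 'rV[R]_n) :
  (forall k j, 0 <= A k j) -> (forall k, exists j, 1 <= A k j) ->
  exists c : 'rV[R]_m.+1, forall k, [/\ 0 <= c ord0 k,
    0 <= \sum_j ((c *m A) ord0 j - d ord0 j) * A k j &
    c ord0 k * \sum_j ((c *m A) ord0 j - d ord0 j) * A k j = 0].
Proof.
move=> A0 A1.
pose f (c : 'rV[R]_m.+1) := \sum_j ((c *m A) ord0 j - d ord0 j) ^+ 2.
pose C := \sum_j `|d ord0 j| ^+ 2.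
pose B := \sum_j `|d ord0 j| + C + 1.
have S0 : 0 <= \sum_j `|d ord0 j| by apply: sumr_ge0.
have C0 : 0 <= C by apply: sumr_ge0 => j _; exact: sqr_ge0.
have B0 : 0 < B by rewrite /B; lra.
pose box := [set c : 'rV[R]_m.+1 | forall k, c ord0 k \in `[0, B]].
have cbox : compact box.
  by apply: (@rV_compact _ _ (fun=> `[0, B]%classic)) => _; exact: segment_compact.
have fcont : continuous f.
  move=> c; rewrite /f.
  apply: cvg_big => [x||j _]; [exact: add_continuous|exact: (nbhs_filter c)|].
  apply: (@continuous_comp _ _ _ (fun c : 'rV[R]_m.+1 => (c *m A) ord0 j - d ord0 j)
    (@GRing.exp R ^~ 2%N)); last exact: exprn_continuous.
  apply: (@continuousB _ _ _ (fun c : 'rV[R]_m.+1 => (c *m A) ord0 j));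
    last exact: cst_continuous.
  have -> : (fun c : 'rV[R]_m.+1 => (c *m A) ord0 j) =
            (fun c => \sum_k c ord0 k * A k j) by apply: funext => x; rewrite mxE.
  apply: cvg_big => [x||k _]; [exact: add_continuous|exact: (nbhs_filter c)|].
  apply: (@continuousM _ _ (fun c : 'rV[R]_m.+1 => c ord0 k) (fun=> A k j));
    last exact: cst_continuous.
  exact: coord_continuous.
have [||c] := @EVT_min_rV R m.+1 f _ _ cbox.
- by exists 0 => k; rewrite mxE in_itv /= lexx ltW.
- exact/continuous_subspaceT.
rewrite inE => cB cmin; exists c => k.
have /andP[ck0 ckB] : 0 <= c ord0 k <= B by have := cB k; rewrite in_itv.
have f0 : f 0 = C.
  by apply: eq_bigr => j _; rewrite mul0mx mxE sub0r sqrrN real_normK ?num_real.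
(* If the coordinate were B, an entry at least 1 in row k would make some coordinate of c A exceed
   that of d by at least C + 1; its square alone beats the cost C of c = 0. *)
have {}ckB : c ord0 k < B.
  rewrite lt_neqAle ckB andbT; apply/negP => /eqP ckE.
  have [j Akj] := A1 k.
  have : f c <= C.
    rewrite -f0; apply: cmin; rewrite inE => i.
    by rewrite mxE in_itv /= lexx ltW.
  apply/negP; rewrite -ltNge.
  apply: (@lt_le_trans _ _ (((c *m A) ord0 j - d ord0 j) ^+ 2)); last first.
    by rewrite /f (bigD1 j) //= lerDl sumr_ge0 // => i _; exact: sqr_ge0.
  have : B <= (c *m A) ord0 j.
    rewrite mxE (bigD1 k) //= ler_wpDr //.
      apply: sumr_ge0 => i _; apply: mulr_ge0 => //.
      by have := cB i; rewrite in_itv => /andP[].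
    by rewrite ckE ler_peMr // ltW.
  have : `|d ord0 j| <= \sum_j `|d ord0 j| by rewrite (bigD1 j) //= lerDl sumr_ge0.
  have := ler_norm (d ord0 j); rewrite /B; nra.
pose a := \sum_j ((c *m A) ord0 j - d ord0 j) * A k j.
pose q := \sum_j A k j ^+ 2.
have fE t : f (c + t *: delta_mx ord0 k) = f c + 2 * t * a + t ^+ 2 * q.
  rewrite /f /a /q !mulr_sumr -!big_split; apply: eq_bigr => j _ /=.
  by rewrite mulmxDl -scalemxAl -rowE !mxE; ring.
have var t : - c ord0 k <= t <= B - c ord0 k -> 0 <= 2 * t * a + t ^+ 2 * q.
  move=> /andP[t1 t2].
  suff : f c <= f (c + t *: delta_mx ord0 k) by rewrite fE; lra.
  apply: cmin; rewrite inE => i; rewrite !mxE eqxx /=.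
  have := cB i; rewrite !in_itv /=.
  case: eqVneq => [->|_] /andP[c0 c1]; rewrite ?mulr1 ?mulr0; apply/andP; split; lra.
have a0 : 0 <= a.
  apply: (@quadratic_ge0_slope _ a q (B - c ord0 k)); first by rewrite subr_gt0.
  by move=> t /andP[t0 t1]; apply: var; rewrite t1 andbT; lra.
split=> //; apply/eqP; rewrite mulf_eq0 -/a orbC eq_le a0 andbT orbC.
have [//|ck] := eqVneq (c ord0 k) 0; rewrite -oppr_ge0 /=.
apply: (@quadratic_ge0_slope _ (- a) q (c ord0 k)); first by rewrite lt_def ck.
move=> t /andP[t0 t1].
have -> : 2 * t * - a + t ^+ 2 * q = 2 * (- t) * a + (- t) ^+ 2 * q by ring.
by apply: var; apply/andP; split; lra.
Qed.

(** * Gaps of the semigroup *)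

Section GammaGaps.
Variable G : numerical_semigroup.
Hypothesis G_proper : carrier G <> setT.

Lemma gamma_le : {homo gamma G : i j / (i <= j)%N}.
Proof.
move=> i j; rewrite leq_eqVlt => /orP[/eqP -> //|ij].
exact/ltnW/(gamma_lt G).
Qed.

Lemma gamma_ci_add j : gamma G (ci G + j) = (cond G + j)%N.
Proof.
elim: j => [|j IH]; first by rewrite !addn0 gamma_ci.
apply/eqP; rewrite eqn_leq !addnS -{2}IH gamma_ltS andbT.
have [i iE] := gamma_surj (condP (leq_trans (leq_addr j _) (leqnSn (cond G + j)))).
rewrite -iE leqNgt; apply/negP => lti.
have : (i <= ci G + j)%N.
  by rewrite leqNgt; apply/negP => /gamma_le; rewrite leqNgt lti.
by move=> /gamma_le; rewrite IH iE ltnn.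
Qed.

Lemma gamma_geid i : (i <= gamma G i)%N.
Proof. by elim: i => // i IH; exact: leq_ltn_trans IH (gamma_ltS G i). Qed.

Lemma ci_gt0 : (0 < ci G)%N.
Proof.
rewrite lt0n; apply/eqP => ci0; apply: G_proper; apply/seteqP; split=> // n _.
by apply: condP; rewrite -gamma_ci ci0.
Qed.

(** Were the two elements consecutive integers, every n from the earlier one on would lie in G,
    against the minimality of [cond G]. *)
Lemma gamma_pred_ci : ((gamma G (ci G).-1).+1 < gamma G (ci G))%N.
Proof.
have := gamma_ltS G (ci G).-1; rewrite (prednK ci_gt0) leq_eqVlt => /orP[/eqP E|//].
suff : (cond G <= gamma G (ci G).-1)%N by rewrite -gamma_ci -E ltnn.
rewrite {1}/cond; case: ex_minnP => c _; apply; apply/asboolP => n.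
rewrite leq_eqVlt => /orP[/eqP <-|]; first exact: gamma_in.
by rewrite E gamma_ci; exact: condP.
Qed.

Lemma gamma1_gt1 : (1 < gamma G 1)%N.
Proof.
have := gamma_ltS G 0; rewrite leq_eqVlt => /orP[/eqP E|//].
exfalso; apply: G_proper; apply/seteqP; split=> // n _.
elim: n => [|n IH]; first exact: carrier0.
by rewrite -addn1; apply: carrierD => //; rewrite E; exact: gamma_in.
Qed.

End GammaGaps.

(** * Discrete antiderivatives and summation by parts *)

Section Moments.
Variables (R : realType) (G : numerical_semigroup).
Implicit Types r h v c : nat -> R.

Definition gammaR i : R := (gamma G i)%:R.
Local Notation g := gammaR.
Local Notation p := (ci G).

Lemma g_lt i j : (i < j)%N -> g i < g j.
Proof. by move=> ij; rewrite ltr_nat; exact: (gamma_lt G). Qed.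

Lemma g_le i j : (i <= j)%N -> g i <= g j.
Proof. by move=> ij; rewrite ler_nat; exact: gamma_le. Qed.

Lemma g0 : g 0 = 0. Proof. by []. Qed.

Lemma g_ci_add j : g (p + j) = g (p) + j%:R.
Proof. by rewrite /gammaR gamma_ci_add gamma_ci natrD. Qed.

Lemma gS i : (p <= i)%N -> g i.+1 = g i + 1.
Proof. by move=> /subnKC <-; rewrite -addnS !g_ci_add -natr1 addrA. Qed.

(** Discrete antiderivatives along the grid [gamma]: [moment r] has slope [mass r n.+1] between grid
    points n and n + 1, and [moment r k] pairs [r] with the ramp ending at k. *)
Definition mass r n := \sum_(0 <= i < n) r i.
Definition moment r n := \sum_(0 <= i < n) (g n - g i) * r i.

Lemma mass0 r : mass r 0 = 0. Proof. by rewrite /mass big_nil. Qed.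
Lemma moment0 r : moment r 0 = 0. Proof. by rewrite /moment big_nil. Qed.

Lemma massS r n : mass r n.+1 = mass r n + r n.
Proof. by rewrite /mass big_nat_recr. Qed.

Lemma momentS r n : moment r n.+1 = moment r n + mass r n.+1 * (g n.+1 - g n).
Proof.
rewrite /moment big_nat_recr //= massS [(mass r n + _) * _]mulrDl /mass mulr_suml addrA -big_split /=.
by congr (_ + _); [apply: eq_bigr => i _|]; ring.
Qed.

Lemma eq_mass r s n : (forall i, (i < n)%N -> r i = s i) -> mass r n = mass s n.
Proof. by move=> rs; apply: eq_big_nat => i /andP[_ /rs]. Qed.

Lemma eq_moment r s n : (forall i, (i < n)%N -> r i = s i) -> moment r n = moment s n.
Proof. by move=> rs; apply: eq_big_nat => i /andP[_ /rs ->]. Qed.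

(** Taylor expansion of the moment at k, with [mass r k] as slope and the later residuals as
    remainder. *)
Lemma moment_split r k n : (k <= n)%N ->
  moment r n = moment r k + mass r k * (g n - g k)
               + \sum_(k <= i < n) (g n - g i) * r i.
Proof.
move=> kn; rewrite /moment (big_cat_nat (leq0n k) kn) /=; congr (_ + _).
rewrite /mass mulr_suml -big_split /=; apply: eq_bigr => i _; ring.
Qed.

(** [mass r k] is the slope of the moment on the step ending at k, where the moment comes down to 0.
    At k = 0 there is no such step and the mass is 0. *)
Lemma mass_le0 r k : moment r k = 0 -> ((0 < k)%N -> 0 <= moment r k.-1) ->
  mass r k <= 0.
Proof.
case: k => [_ _|k + /(_ isT) /=]; first by rewrite mass0.
rewrite momentS => /eqP; rewrite addrC addr_eq0 => /eqP Mk; rewrite -oppr_le0 -Mk.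
by rewrite pmulr_lle0 // subr_gt0 g_lt.
Qed.

Lemma mass_ge0 r k : moment r k <= 0 -> 0 <= moment r k.+1 -> 0 <= mass r k.+1.
Proof.
rewrite momentS => Mk M1; have : 0 <= mass r k.+1 * (g k.+1 - g k) by lra.
by rewrite pmulr_lge0 // subr_gt0 g_lt.
Qed.

(** Plays the part of [slope] for sequences of unbounded length. At i = 0 the numerator vanishes and
    the value is 0. *)
Definition chord v i := (v i - v i.-1) / (g i - g i.-1).

Lemma chordK v i : chord v i.+1 * (g i.+1 - g i) = v i.+1 - v i.
Proof. by rewrite /chord divfK // subr_eq0 gt_eqF // g_lt. Qed.

(** Summation by parts twice: once the boundary terms vanish, the pairing with [v] depends only on
    the corners of [v]. The term k = 0 is 0 because [moment r 0] is. *)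
Lemma double_abel r v n :
  \sum_(0 <= i < n.+1) r i * v i = mass r n.+1 * v n - moment r n * chord v n
    + \sum_(0 <= k < n) moment r k * (chord v k.+1 - chord v k).
Proof.
elim: n => [|n IH].
  by rewrite big_nat1 big_nil massS mass0 moment0; ring.
rewrite big_nat_recr //= IH [in RHS]big_nat_recr //= (massS r n.+1) momentS.
have := chordK v n; set s := chord v n.+1 => sE.
have -> : v n.+1 = v n + s * (g n.+1 - g n) by rewrite sE addrC subrK.
ring.
Qed.

(** * Convex splines and the defect *)

(** Generators of the cone of convex sequences vanishing from some index on; for k > 0 the only
    corner of [ramp k] is at k. *)
Definition ramp k i : R := if (i < k)%N then g k - g i else 0.

Lemma ramp_ge0 k i : 0 <= ramp k i.
Proof. by rewrite /ramp; case: ifP => // ik; rewrite subr_ge0 g_le // ltnW. Qed.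

Definition spline c M i := \sum_(0 <= k < M.+1) c k * ramp k i.

Lemma spline_diff c M i :
  spline c M i - spline c M i.+1 =
  (g i.+1 - g i) * \sum_(0 <= k < M.+1 | (i < k)%N) c k.
Proof.
rewrite /spline -sumrB mulr_sumr [RHS]big_mkcond; apply: eq_bigr => k _.
rewrite /ramp; case: (ltnP i k) => ik; last by rewrite ltnNge leqW // mulr0 subr0.
case: ltnP => ik'; first by ring.
have -> : k = i.+1 by apply/eqP; rewrite eqn_leq ik ik'.
ring.
Qed.

Lemma chord_spline c M i : chord (spline c M) i.+1 = - \sum_(0 <= k < M.+1 | (i < k)%N) c k.
Proof.
rewrite /chord -opprB spline_diff /= mulrC -mulrN mulKf //.
by rewrite subr_eq0 gt_eqF // g_lt.
Qed.

(** Passing i removes exactly the term k = i from the sum of slopes, so the coefficients measure the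
    corners. *)
Lemma chord_spline_jump c M i : (1 <= i <= M)%N ->
  chord (spline c M) i.+1 - chord (spline c M) i = c i.
Proof.
case: i => // i iM; rewrite !chord_spline opprK addrC.
apply/eqP; rewrite subr_eq; apply/eqP.
rewrite big_mkcond (bigD1_seq i.+1) ?iota_uniq ?mem_index_iota //= ltnSn.
congr (_ + _); rewrite -big_mkcondr; apply: eq_bigl => k.
by rewrite [RHS]ltn_neqAle eq_sym.
Qed.

(* At i = 0 the truncated predecessor gives the right value, as gamma 0 = 0. *)
Definition defect i : R := g i.+1 - g i.-1 - 2.

Lemma defect_gt_ci i : (p < i)%N -> defect i = 0.
Proof.
case: i => // i; rewrite ltnS => ii.
by rewrite /defect /= !gS ?leqW //; ring.
Qed.

Lemma defect_ge0 i : carrier G <> setT -> 0 <= defect i.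
Proof.
move=> Gp; case: i => [|i].
  by rewrite /defect /= g0 subr0 subr_ge0 ler_nat gamma1_gt1.
rewrite /defect /= /gammaR.
have : (gamma G i + 2 <= gamma G i.+2)%N.
  by rewrite addn2; exact: leq_ltn_trans (gamma_ltS _ _) (gamma_ltS _ _).
by rewrite -(ler_nat R) natrD; lra.
Qed.

(** The gap before the conductor is at least 2 and the one after it is 1. *)
Lemma defect_ci_gt0 : carrier G <> setT -> 0 < defect (p).
Proof.
move=> Gp; rewrite /defect gS //; have := gamma_pred_ci Gp.
by rewrite -(ler_nat R) -natr1 -natr1 /gammaR; lra.
Qed.

(** * The best convex fit of the defect and its support *)

(** Nonnegative least squares with ramps as rows. The gradient along [ramp k] is the moment of the
    residual at k, since the ramp cuts the sum off there. *)
Lemma nonneg_spline_fit d M : (0 < M)%N -> exists c,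
  [/\ forall k, 0 <= c k, c 0%N = 0,
      forall k, (k <= M)%N -> 0 <= moment (fun i => spline c M i - d i) k &
      forall k, (k <= M)%N -> c k * moment (fun i => spline c M i - d i) k = 0].
Proof.
case: M => // M _.
(* Rows are shifted by one because [ramp 0] is zero; [e] below undoes the shift. *)
pose A := \matrix_(k < M.+1, i < M.+1) ramp k.+1 i.
have [k i|k|c cP] := @nonneg_least_squares R M M.+1 A (\row_i d i).
- by rewrite mxE ramp_ge0.
- exists k; rewrite mxE /ramp ltnSn.
  by have := gamma_ltS G k; rewrite -(ler_nat R) -natr1 /gammaR; lra.
pose e k : R := if k is k'.+1 then if (k' < M.+1)%N then c ord0 (inord k') else 0 else 0.
exists e.
have eE (k : 'I_M.+1) : e k.+1 = c ord0 k by rewrite /e ltn_ord inord_val.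
have sE (i : 'I_M.+1) : spline e M.+1 i = (c *m A) ord0 i.
  rewrite /spline big_nat_recl //= mul0r add0r big_mkord mxE.
  by apply: eq_bigr => k _; rewrite ltn_ord inord_val mxE.
have mE (k : 'I_M.+1) : moment (fun i => spline e M.+1 i - d i) k.+1 =
    \sum_j ((c *m A) ord0 j - (\row_i d i) ord0 j) * A k j.
  rewrite /moment big_mkord.
  rewrite (big_ord_widen M.+1 (fun i => (g k.+1 - g i) * (spline e M.+1 i - d i))) //.
  rewrite big_mkcond; apply: eq_bigr => i _; rewrite sE !mxE /ramp.
  by case: ifP => _; rewrite ?mulr0 // mulrC.
split=> // [[|k] //=|[|k] kM|[|k] kM].
- by case: ifP => // kM; have [] := cP (inord k).
- by rewrite moment0.
- by have [_ + _] := cP (Ordinal kM); rewrite -mE.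
- by rewrite mul0r.
- by have [_ _] := cP (Ordinal kM); rewrite -mE -eE.
Qed.

(** The default k = 0 suits the uses below, as every moment vanishes at 0. *)
Lemma last_positive c n : (forall k, 0 <= c k) -> exists k,
  [/\ (k <= n)%N, k = 0%N \/ 0 < c k & forall j, (k < j <= n)%N -> c j = 0].
Proof.
move=> c0; elim: n => [|n [k [kn ck cj]]].
  by exists 0%N; split=> // [|j]; [left|lia].
have [cn|cn] := eqVneq (c n.+1) 0.
  exists k; split=> // [|j]; first exact: leqW.
  rewrite [(j <= _)%N]leq_eqVlt => /andP[kj /orP[/eqP -> //|jn]].
  by apply: cj; rewrite kj -ltnS.
exists n.+1; split=> // [|j]; last by lia.
by right; rewrite lt_def cn c0.
Qed.

(* Chosen so that in the sum of the next lemma the single term i = far outweighs all the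
   terms with i < ci. *)
Definition far := (p + (2 * cond G ^ 2).+1)%N.

(** At most [g p] terms lie before [p], each at least - g p * g X. The term at [far] is (2 (g p)^2 +
    1) (g X - g far), which wins because g X >= 2 g far. *)
Lemma weighted_ramp_gt0 a M X : (a <= p)%N -> (2 * gamma G far <= gamma G X)%N ->
  (X <= M)%N -> 0 < \sum_(a <= i < M) (g i - g p) * ramp X i.
Proof.
move=> ap farX XM.
have far_gt0 : (0 < gamma G far)%N.
  by apply: leq_trans (gamma_geid G _); rewrite /far addnS.
have fX : (far < X)%N.
  by rewrite ltnNge; apply/negP => Xf; have := gamma_le G Xf; lia.
have pf : (p < far)%N by rewrite /far addnS ltnS leq_addr.
have pM : (p <= M)%N := leq_trans (ltnW (ltn_trans pf fX)) XM.
rewrite (big_cat_nat ap pM) /=.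
have gp : g p = (cond G)%:R by rewrite /gammaR gamma_ci.
have gfar : g far = g p + (2 * g p ^+ 2 + 1).
  by rewrite /far g_ci_add gp -natr1 natrM natrX.
have gX0 : 0 <= g X by rewrite ler0n.
have gp0 : 0 <= g p by rewrite ler0n.
have near : - (g p ^+ 2 * g X) <= \sum_(a <= i < p) (g i - g p) * ramp X i.
  have : \sum_(a <= i < p) - (g p * g X) <= \sum_(a <= i < p) (g i - g p) * ramp X i.
    apply: ler_sum_nat => i /andP[_ ip].
    have iX : (i < X)%N by apply: ltn_trans ip (ltn_trans pf fX).
    have := g_lt ip; have := g_lt iX.
    have : 0 <= g i by rewrite ler0n.
    rewrite /ramp iX; nra.
  apply: le_trans; rewrite sumr_const_nat -mulr_natr mulNr lerN2.
  rewrite expr2 [g p * g p * _]mulrAC ler_wpM2l ?mulr_ge0 //.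
  by rewrite ler_nat (leq_trans (leq_subr _ _)) // gamma_geid.
have one : (2 * g p ^+ 2 + 1) * (g X - g far) <= \sum_(p <= i < M) (g i - g p) * ramp X i.
  have -> : (2 * g p ^+ 2 + 1) * (g X - g far) = (g far - g p) * ramp X far.
    by rewrite /ramp fX {2}gfar; ring.
  rewrite (bigD1_seq far) ?iota_uniq ?mem_index_iota ?(ltnW pf) ?(leq_trans fX) //=.
  rewrite lerDl big_seq_cond sumr_ge0 // => i; rewrite mem_index_iota => /andP[/andP[pi _] _].
  by rewrite mulr_ge0 ?ramp_ge0 // subr_ge0 g_le.
have : 2 * g far <= g X by rewrite -natrM ler_nat.
have : 0 < g far by rewrite ltr0n.
move: near one; set S1 := \sum_(_ <= _ < _) _.
set S2 := \sum_(_ <= _ < _) _; set q := g p ^+ 2.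
have q0 : 0 <= q by apply: sqr_ge0.
move=> n o f0 fX2; have : 0 <= (q + 1) * (g X - 2 * g far) by apply: mulr_ge0; lra.
lra.
Qed.

(* Past ci the moment of h - d has second difference h, positive below M, so it cannot vanish
   at M and at some a with ci <= a <= M - 2. If instead all the corners other than M - 1 and M
   lie before ci, then h is affine between the last of these and M - 1, and its weight beyond
   ci is too large. *)
Lemma top_corner_vanishes c M (h := spline c M) (r := fun i => h i - defect i) :
  carrier G <> setT -> (2 * gamma G far < M)%N -> (forall k, 0 <= c k) ->
  (forall k, (k <= M)%N -> 0 <= moment r k) ->
  (forall k, (k <= M)%N -> c k * moment r k = 0) ->
  c M = 0.
Proof.
case: M @h @r => [//|[|M]] h r.
  by move=> _; rewrite ltnS leqn0 muln_eq0 /= => /eqP f0; have := gamma_geid G far; rewrite f0 /far; lia.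
move=> Gp farM c0 m0 cm; apply/eqP; rewrite eq_le c0 andbT leNgt; apply/negP => cM.
have mM : moment r M.+2 = 0.
  by apply/eqP; have := cm _ (leqnn _); move/eqP; rewrite mulf_eq0 gt_eqF.
have h_gt0 i : (i < M.+2)%N -> 0 < h i.
  move=> iM; rewrite /h /spline big_nat_recr //=; apply: ltr_wpDl.
    by apply: sumr_ge0 => k _; apply: mulr_ge0; [exact: c0 | exact: ramp_ge0].
  by rewrite mulr_gt0 // /ramp iM subr_gt0 g_lt.
(* The two top indices are left out: beyond [a], corners of [h] can only be at M + 1 and M + 2. *)
have [a [aM ca cj]] := @last_positive c M c0.
have ma : moment r a = 0.
  case: ca => [->|ca]; first exact: moment0.
  by apply/eqP; have /eqP := cm a (leqW (leqW aM)); rewrite mulf_eq0 gt_eqF.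
have [pa|ap] := leqP p a.
  (* From [a] on the moment is convex, with positive slope after the first step, so it cannot return
     to 0 at M + 2. *)
  have incr n : (a + n < M.+2)%N -> 0 <= moment r (a + n) /\ 0 <= mass r (a + n).+1
      /\ ((0 < n)%N -> 0 < mass r (a + n).+1 ).
    elim: n => [|n IH] an.
      rewrite addn0 ma; split=> //; split=> //.
      by apply: mass_ge0; rewrite ?ma // m0 // ltnW // ltnS.
    have [|mn [sn _]] := IH; first by lia.
    split; first by apply: m0; lia.
    have hn := h_gt0 _ an.
    have -> : mass r (a + n.+1).+1 = mass r (a + n).+1 + h (a + n.+1)%N.
      by rewrite [LHS]massS addnS {2}/r defect_gt_ci ?subr0 // ltnS (leq_trans pa) // leq_addr.
    by split=> [|_]; lra.
  have aE : (a + (M.+1 - a))%N = M.+1 by lia.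
  have := incr (M.+1 - a)%N; rewrite aE => /(_ (leqnn _)) [m1 [_]].
  rewrite subn_gt0 ltnS => /(_ aM) s1.
  have := momentS r M.+1; rewrite mM.
  have : 0 < mass r M.+2 * (g M.+2 - g M.+1) by rewrite mulr_gt0 // subr_gt0 g_lt.
  lra.
have sa : mass r a <= 0.
  by apply: mass_le0 => // a0; apply: m0; lia.
have sM : mass r M.+2 <= 0 by apply: mass_le0 => // _; apply: m0.
(* The weight is affine in [g i] and the moments vanish at both ends, so only the two masses, both
   nonpositive, survive. *)
have split_r : \sum_(a <= i < M.+2) (g i - g p) * r i
    = (g M.+2 - g p) * mass r M.+2 + (g p - g a) * mass r a.
  have aM2 : (a <= M.+2)%N by lia.
  have := moment_split r aM2; rewrite mM ma add0r => /esym/eqP.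
  rewrite addrC addr_eq0 => /eqP E.
  have -> : mass r M.+2 = mass r a + \sum_(a <= i < M.+2) r i.
    by rewrite /mass (big_cat_nat _ aM2).
  have : \sum_(a <= i < M.+2) (g i - g p) * r i =
    (g M.+2 - g p) * (\sum_(a <= i < M.+2) r i) - \sum_(a <= i < M.+2) (g M.+2 - g i) * r i.
    by rewrite mulr_sumr -sumrB; apply: eq_bigr => i _; ring.
  by rewrite E => ->; ring.
have pM : (p < M.+2)%N by apply: leq_ltn_trans farM; have := gamma_geid G far; rewrite /far; lia.
have r_le0 : \sum_(a <= i < M.+2) (g i - g p) * r i <= 0.
  rewrite split_r; have : 0 < g M.+2 - g p by rewrite subr_gt0 g_lt.
  have : 0 < g p - g a by rewrite subr_gt0 g_lt.
  nra.
(* The weight is nonpositive up to [p], and the defect vanishes after it. *)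
have d_le0 : \sum_(a <= i < M.+2) (g i - g p) * defect i <= 0.
  apply: sumr_le0 => i _; have [ip|pi] := leqP i p; last by rewrite defect_gt_ci ?mulr0.
  by rewrite mulr_le0_ge0 ?defect_ge0 // subr_le0 g_le.
have : \sum_(a <= i < M.+2) (g i - g p) * h i <= 0.
  rewrite (_ : \sum_(a <= i < M.+2) _ = \sum_(a <= i < M.+2) (g i - g p) * r i
     + \sum_(a <= i < M.+2) (g i - g p) * defect i); first by lra.
  by rewrite -big_split /=; apply: eq_bigr => i _; rewrite /r; ring.
apply/negP; rewrite -ltNge.
rewrite (_ : \sum_(a <= i < M.+2) _ =
  c M.+1 * (\sum_(a <= i < M.+2) (g i - g p) * ramp M.+1 i) +
  c M.+2 * (\sum_(a <= i < M.+2) (g i - g p) * ramp M.+2 i)).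
  have W X : (M < X <= M.+2)%N -> 0 < \sum_(a <= i < M.+2) (g i - g p) * ramp X i.
    move=> /andP[MX XM]; apply: weighted_ramp_gt0 => //; first exact: ltnW.
    by apply: leq_trans (gamma_geid G X); lia.
  have := W M.+1; have := W M.+2; rewrite !ltnS !leqnn leqnSn => /(_ isT) W2 /(_ isT) W1.
  by rewrite ltr_wpDl ?mulr_ge0 ?mulr_gt0 // ltW.
rewrite !mulr_sumr -big_split; apply: eq_big_nat => i /andP[ai _] /=.
rewrite /h /spline big_nat_recr //= big_nat_recr //=.
rewrite big_nat big1 => [|k /andP[_ kM]]; first by ring.
have [ki|ik] := leqP k i; first by rewrite /ramp ltnNge ki mulr0.
by rewrite cj ?mul0r // (leq_ltn_trans ai ik) -ltnS.
Qed.

(** Here [l] is the last corner of the fit. The vanishing of the moment at both [l] and [l.-1] is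
    what allows another tail to be attached at [l]. *)
Lemma finite_support_fit : carrier G <> setT -> exists (l : nat) (h : nat -> R),
  let r := fun i => h i - defect i in
  [/\ (p < l)%N, forall i, (l <= i)%N -> h i = 0, 0 < h l.-1,
      moment r l = 0 /\ moment r l.-1 = 0 &
      [/\ forall i, (1 <= i < l)%N -> chord h i <= chord h i.+1,
      forall k, (k <= l)%N -> 0 <= moment r k &
      forall k, (1 <= k < l)%N -> moment r k * (chord h k.+1 - chord h k) = 0]].
Proof.
move=> Gp; pose M := (2 * gamma G far).+1.
have [//|c [c0 c00 m0 cm]] := @nonneg_spline_fit defect M.
set h := spline c M in m0 cm; set r := fun i => _ in m0 cm.
have cM : c M = 0 by apply: top_corner_vanishes.
have pM : (p.+1 < M)%N.
  by rewrite /M; have := gamma_geid G far; rewrite /far; lia.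
have [l [lM cl cj]] := @last_positive c M c0.
have {}lM : (l < M)%N.
  rewrite ltn_neqAle lM andbT; apply/eqP => lE.
  by case: cl => [l0|]; [move: pM; rewrite -lE l0 | rewrite lE cM ltxx].
have h0 i : (l <= i)%N -> h i = 0.
  move=> li; rewrite /h /spline big_nat big1 // => k /andP[_ kM].
  have [ki|ik] := leqP k i; first by rewrite /ramp ltnNge ki mulr0.
  by rewrite cj ?mul0r // (leq_ltn_trans li ik) -ltnS.
have ml : moment r l = 0.
  case: cl => [->|cl]; first exact: moment0.
  by apply/eqP; have /eqP := cm l (ltnW lM); rewrite mulf_eq0 gt_eqF.
have sl : mass r l <= 0.
  by apply: mass_le0 => // l0; apply: m0; lia.
(* If l <= p, the residual from [l] on is minus the defect, which is negative at [p]; the moment at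
   M would then be negative. *)
have pl : (p < l)%N.
  rewrite ltnNge; apply/negP => lp.
  have := moment_split r (ltnW lM); rewrite ml add0r.
  have := m0 M (leqnn _).
  have : mass r l * (g M - g l) <= 0.
    by rewrite mulr_le0_ge0 // subr_ge0 g_le // ltnW.
  suff : \sum_(l <= i < M) (g M - g i) * r i < 0 by lra.
  rewrite (bigD1_seq p) ?iota_uniq ?mem_index_iota ?lp ?(ltnW pM) //=.
  apply: ltr_wnDr.
    rewrite big_seq_cond sumr_le0 // => i; rewrite mem_index_iota => /andP[/andP[li iM] _].
    rewrite mulr_ge0_le0 // ?subr_ge0 ?g_le // 1?ltnW //.
    by rewrite /r h0 // sub0r oppr_le0 defect_ge0.
  rewrite pmulr_rlt0 ?subr_gt0 ?g_lt 1?ltnW // /r h0 // sub0r oppr_lt0.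
  exact: defect_ci_gt0.
have l_gt0 : (0 < l)%N by lia.
have {}cl : 0 < c l by case: cl => // l0; move: l_gt0; rewrite l0.
(* The residual at [l] is 0, so the moment has the same slope on both sides of its zero [l]; being
   nonnegative, it is flat there. *)
have {}sl : mass r l = 0.
  apply/eqP; rewrite eq_le sl /=.
  have : 0 <= mass r l.+1 by apply: mass_ge0; rewrite ?ml ?m0.
  by rewrite massS {2}/r h0 // defect_gt_ci // subr0 addr0.
exists l, h; split=> //.
- have lE : l.-1.+1 = l by rewrite prednK.
  have := spline_diff c M l.-1; rewrite lE -/h (h0 l) // subr0 => ->.
  rewrite pmulr_rgt0 ?subr_gt0 ?g_lt ?ltn_predL //.
  rewrite big_mkcond (bigD1_seq l) ?iota_uniq ?mem_index_iota //= ?ltnS ?(ltnW lM) //.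
  rewrite leqnn ltr_wpDr // sumr_ge0 // => k _.
  by case: ifP.
- split=> //; have := momentS r l.-1.
  by rewrite prednK // sl mul0r addr0 ml.
have jump i : (1 <= i < l)%N -> chord h i.+1 - chord h i = c i.
  by move=> /andP[i1 il]; apply: chord_spline_jump; rewrite i1 ltnW // (ltn_trans il).
split=> [i /jump j|k kl|k kl]; first by rewrite -subr_ge0 j.
- by apply: m0; lia.
- by rewrite jump // mulrC cm //; lia.
Qed.

(** * Optimality conditions in terms of moments, and the regression line *)

Lemma targetS N i : (i < N)%N -> target R G N i.+1 = 2 + defect i.
Proof.
move=> iN; rewrite /target eqSS ltn_eqF //= /defect.
by case: i iN => [|i] _ /=; rewrite ?subSS ?subn0 /gammaR /=; ring.
Qed.

Lemma slope_row N (v : nat -> R) i : (i <= N)%N ->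
  slope G (\row_(j < N.+1) v j) i = chord v i.
Proof.
by move=> iN; rewrite /slope /entry !mxE !inordK // ltnS (leq_trans (leq_pred _)).
Qed.

(* The KKT conditions; the double Abel summation turns the first order condition
   into a combination of nonnegative terms. *)
Lemma minimizer_of_moments N (v : nat -> R)
    (r := fun i => v i - target R G N i.+1) :
  (forall i, (1 <= i < N)%N -> chord v i <= chord v i.+1) ->
  (forall k, (k < N)%N -> 0 <= moment r k) ->
  (forall k, (1 <= k < N)%N -> moment r k * (chord v k.+1 - chord v k) = 0) ->
  mass r N.+1 = 0 -> moment r N = 0 ->
  is_minimizer G (\row_(j < N.+1) v j).
Proof.
move=> vW r0 rv rN mN; split=> [i iN|u uW].
  by rewrite !slope_row ?vW //; lia.
pose x i := entry u i.
have xW i : (1 <= i < N)%N -> chord x i <= chord x i.+1.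
  by move=> iN; apply: uW; lia.
(* Pairing with [r] only sees corners: it is zero on [v] by slackness and nonnegative on the
   cone. *)
have dot y : \sum_(0 <= i < N.+1) r i * y i =
    \sum_(0 <= k < N) moment r k * (chord y k.+1 - chord y k).
  by rewrite double_abel rN mN !mul0r subr0 add0r.
have v_orth : \sum_(0 <= i < N.+1) r i * v i = 0.
  rewrite dot big_nat big1 // => -[|k] kN; first by rewrite moment0 mul0r.
  exact: rv.
have x_dual : 0 <= \sum_(0 <= i < N.+1) r i * x i.
  rewrite dot big_nat sumr_ge0 // => -[|k] kN; first by rewrite moment0 mul0r.
  by rewrite mulr_ge0 ?r0 // subr_ge0 xW.
have -> : cost G (\row_(j < N.+1) v j) = \sum_(0 <= i < N.+1) r i ^+ 2.
  by apply: eq_big_nat => i /andP[_ iN]; rewrite /entry mxE inordK.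
have -> : cost G u = \sum_(0 <= i < N.+1) r i ^+ 2 + \sum_(0 <= i < N.+1) (x i - v i) ^+ 2
    + 2 * (\sum_(0 <= i < N.+1) r i * x i - \sum_(0 <= i < N.+1) r i * v i).
  rewrite mulrBr !mulr_sumr -sumrB -!big_split /=.
  by apply: eq_bigr => i _; rewrite /r -/(x i); ring.
have : 0 <= \sum_(0 <= i < N.+1) (x i - v i) ^+ 2.
  by apply: sumr_ge0 => i _; exact: sqr_ge0.
by rewrite v_orth; lra.
Qed.

Lemma global_optimum_eq N (w : 'rV[R]_N.+1) :
  is_minimizer G w -> global_optimum R G N = w.
Proof. by move=> ww; exact: (proj2 (@global_optimumP R G N)). Qed.

(* The regression line of the values 2, ..., 2, 1 at l, ..., N. *)
Definition tail_line l N i : R :=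
  let D : R := (N%:R - l%:R + 1) * (N%:R - l%:R + 2) in
  let m : R := - 6 / D in
  let b : R := 2 + 2 * (N%:R + 2 * l%:R - 1) / D in
  m * i%:R + b.

(** In the length n = N - l and the offset j from l, the dependence on l disappears. *)
Lemma tail_lineE l n j : tail_line l (l + n) (l + j) =
  2 + (2 * (n%:R - 1) - 6 * j%:R) / ((n%:R + 1) * (n%:R + 2)).
Proof.
rewrite /tail_line !natrD.
have -> : l%:R + n%:R - l%:R = n%:R :> R by ring.
have n0 : 0 <= n%:R :> R by rewrite ler0n.
by field; apply/andP; split; apply: lt0r_neq0; lra.
Qed.

(** * The glued candidate: its moments and corners *)

Definition glued (h : nat -> R) l N i := if (i < l)%N then 2 + h i else tail_line l N i.

(** Mass and moment vanish at [l], so the tail starts afresh there. The zero of the closed form at t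
    = n and the zero final mass are the normal equations of the regression. *)
Lemma glued_moments (h : nat -> R) l n
    (r := fun i => glued h l (l + n) i - target R G (l + n) i.+1) :
  (p < l)%N -> (0 < n)%N -> mass (fun i => h i - defect i) l = 0 ->
  moment (fun i => h i - defect i) l = 0 ->
  [/\ forall k, (k <= l)%N -> moment r k = moment (fun i => h i - defect i) k,
      forall t, (t <= n)%N -> moment r (l + t) =
        t%:R * (t%:R + 1) * (n%:R - t%:R) / ((n%:R + 1) * (n%:R + 2)) &
      mass r (l + n).+1 = 0].
Proof.
move=> pl n_gt0 sl ml.
have n0 : 0 <= n%:R :> R by rewrite ler0n.
have rl i : (i < l)%N -> r i = h i - defect i.
  by move=> il; rewrite /r /glued il targetS ?ltn_addr //; ring.
have rt j : (j < n)%N -> r (l + j)%N =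
    (2 * (n%:R - 1) - 6 * j%:R) / ((n%:R + 1) * (n%:R + 2)).
  move=> jn; rewrite /r /glued ltnNge leq_addr /= targetS ?ltn_add2l //.
  by rewrite tail_lineE defect_gt_ci ?ltn_addr //; ring.
(* The last target is 1 instead of 2, hence the extra 1. *)
have rn : r (l + n)%N = (2 * (n%:R - 1) - 6 * n%:R) / ((n%:R + 1) * (n%:R + 2)) + 1.
  rewrite /r /glued ltnNge leq_addr /= tail_lineE /target eqxx; ring.
have mk k : (k <= l)%N -> moment r k = moment (fun i => h i - defect i) k.
  by move=> kl; apply: eq_moment => i ik; apply: rl; apply: leq_trans kl.
have both t : (t <= n)%N ->
    mass r (l + t) = t%:R * (2 * n%:R + 1 - 3 * t%:R) / ((n%:R + 1) * (n%:R + 2)) /\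
    moment r (l + t) = t%:R * (t%:R + 1) * (n%:R - t%:R) / ((n%:R + 1) * (n%:R + 2)).
  elim: t => [|t IH] tn.
    by rewrite addn0 mk // ml (eq_mass rl) sl !mul0r.
  have [mt Mt] := IH (ltnW tn).
  have mS : mass r (l + t.+1) =
      t.+1%:R * (2 * n%:R + 1 - 3 * t.+1%:R) / ((n%:R + 1) * (n%:R + 2)).
    rewrite addnS massS mt rt // -natr1; field.
    by apply/andP; split; apply: lt0r_neq0; lra.
  split=> //; rewrite addnS momentS -addnS mS Mt addnS gS; last by lia.
  rewrite -natr1; field.
  by apply/andP; split; apply: lt0r_neq0; lra.
split=> // [t /both[]//|].
have [mn _] := both n (leqnn n).
rewrite massS mn rn; field.
by apply/andP; split; apply: lt0r_neq0; lra.
Qed.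

Lemma chord_glued_lt (h : nat -> R) l N i : (1 <= i < l)%N ->
  chord (glued h l N) i = chord h i.
Proof.
case/andP=> i1 il; rewrite /chord /glued il (leq_ltn_trans (leq_pred _) il).
by congr (_ / _); ring.
Qed.

Lemma chord_glued_eq (h : nat -> R) l n : (p < l)%N ->
  chord (glued h l (l + n)) l = 2 * (n%:R - 1) / ((n%:R + 1) * (n%:R + 2)) - h l.-1.
Proof.
case: l => // l pl; rewrite /chord /glued ltnn /= leqnn gS //.
have -> : g l + 1 - g l = 1 by ring.
have := tail_lineE l.+1 n 0; rewrite addn0 => ->.
by rewrite invr1 mulr1; ring.
Qed.

Lemma chord_glued_gt (h : nat -> R) l n i : (p <= l)%N -> (l < i)%N ->
  chord (glued h l (l + n)) i = - 6 / ((n%:R + 1) * (n%:R + 2)).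
Proof.
case: i => // i pl li; rewrite /chord /glued ltnNge (ltnW li) /= ltnNge -ltnS li /=.
rewrite gS ?(leq_trans pl) //.
have -> : g i + 1 - g i = 1 by ring.
move: li; rewrite ltnS => /subnKC <-; rewrite -addnS !tail_lineE invr1 -natr1; ring.
Qed.

Lemma chord_last_support (h : nat -> R) l : (p < l)%N ->
  (forall i, (l <= i)%N -> h i = 0) -> chord h l = - h l.-1.
Proof.
case: l => // l pl h0; rewrite /chord h0 // gS //= sub0r.
have -> : g l + 1 - g l = 1 by ring.
by rewrite invr1 mulr1.
Qed.

(** The line starts above 2, which raises the chord into [l] and sharpens the corner at [l.-1]. At
    [l] the chord grows by h l.-1 - 2 / (n + 1), hence the lower bound on [h l.-1]. *)
Lemma glued_jumps (h : nat -> R) l n i : (p < l)%N -> (1 < n)%N ->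
  (forall i, (l <= i)%N -> h i = 0) -> 2 / (n%:R + 1) < h l.-1 -> (1 <= i)%N ->
  [/\ (i < l.-1)%N -> chord (glued h l (l + n)) i = chord h i
        /\ chord (glued h l (l + n)) i.+1 = chord h i.+1,
      i = l.-1 -> chord h i.+1 - chord h i < chord (glued h l (l + n)) i.+1 - chord (glued h l (l + n)) i,
      i = l -> chord (glued h l (l + n)) i < chord (glued h l (l + n)) i.+1 &
      (l < i)%N -> chord (glued h l (l + n)) i = chord (glued h l (l + n)) i.+1].
Proof.
move=> pl n1 h0 hn i1.
have n2 : 2 <= n%:R :> R by rewrite (ler_nat R 2).
have l0 : (0 < l)%N by lia.
split=> [il|iE|iE|il].
- by rewrite !chord_glued_lt //; lia.
- have -> : i.+1 = l by lia.
  rewrite chord_glued_eq // chord_last_support // chord_glued_lt; last by lia.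
  have : 0 < 2 * (n%:R - 1) / ((n%:R + 1) * (n%:R + 2)) :> R.
    by rewrite divr_gt0 // mulr_gt0; lra.
  lra.
- rewrite iE chord_glued_eq // chord_glued_gt //; last exact: ltnW.
  have : 2 / (n%:R + 1) = 2 * (n%:R - 1) / ((n%:R + 1) * (n%:R + 2))
      - (- 6 / ((n%:R + 1) * (n%:R + 2))) :> R.
    by field; apply/andP; split; apply: lt0r_neq0; lra.
  lra.
- by rewrite !chord_glued_gt ?(ltnW pl) // leqW.
Qed.

End Moments.

(** * Stabilization of the optimum and of its face for large N *)

Theorem theorem6p3 (R : realType) (G : numerical_semigroup)
    (G_proper : carrier G <> setT) :
  exists (N0 : nat) (I : {fset nat}),
    [/\ (ci G < N0)%N,
        I != fset0,
        (forall N : nat, (N0 <= N)%N ->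
           (forall i : nat, i \in I -> (1 <= i <= N - 1)%N) /\
           minimal_face G (global_optimum R G N) I) &
        let l := (\max_(i <- I) i)%N in
        (forall N N' i : nat, (N0 <= N)%N -> (N0 <= N')%N -> (i < l)%N ->
           entry (global_optimum R G N) i = entry (global_optimum R G N') i) /\
        (forall N i : nat, (N0 <= N)%N -> (l <= i <= N)%N ->
           let D : R := (N%:R - l%:R + 1) * (N%:R - l%:R + 2) in
           let m : R := - 6 / D in
           let b : R := 2 + 2 * (N%:R + 2 * l%:R - 1) / D in
           entry (global_optimum R G N) i = m * i%:R + b)].
Proof.
have [l [h [pl h0 hl [ml ml1] [hW hm hslack]]]] := finite_support_fit R G_proper.
set r := fun i => _ in ml ml1 hm hslack.
have p0 := ci_gt0 G_proper.
have l2 : (1 < l)%N by lia.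
have sl : mass r l = 0.
  have := momentS G r l.-1; rewrite prednK ?(ltnW l2) // ml ml1 add0r => /esym/eqP.
  by rewrite mulf_eq0 subr_eq0 [_ == gammaR R G _]gt_eqF ?g_lt ?ltn_predL ?(ltnW l2) // orbF => /eqP.
(* The Archimedean bound makes 2 / (n + 1) less than [h l.-1]; adding 2 ensures n > 1. *)
pose n0 := (Num.bound (2 / h l.-1)).+2.
have n0P n : (n0 <= n)%N -> 2 / (n%:R + 1) < h l.-1.
  move=> nn; have : 2 / h l.-1 < n%:R + 1.
    apply: lt_trans (archi_boundP _) _; first by rewrite divr_ge0 // ltW.
    by rewrite natr1 ltr_nat ltnS (leq_trans _ nn) // /n0; lia.
  rewrite ltr_pdivrMr // => hn.
  by rewrite ltr_pdivrMr ?ltr_wpDl // mulrC.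
pose N0 := (l + n0)%N.
(* [l.-1] is listed even if [h] is straight there, since the gluing creates a corner. Nothing here
   depends on N. *)
pose I := [fset i in iota 1 l | [|| i == l.-1, i == l | chord G h i < chord G h i.+1]]%fset.
have lI : l \in I by rewrite !inE mem_iota eqxx orbT; lia.
have maxI : (\max_(i <- I) i)%N = l.
  apply/eqP; rewrite eqn_leq leq_bigmax_seq // andbT.
  by apply/bigmax_leqP_seq => i; rewrite !inE mem_iota; lia.
pose w N := \row_(j < N.+1) glued h l N j.
have main N : (N0 <= N)%N -> is_minimizer G (w N) /\
    (forall i, (1 <= i < N)%N -> (chord G (glued h l N) i < chord G (glued h l N) i.+1) = (i \in I)).
  move=> NN; have -> : N = (l + (N - l))%N by rewrite /N0 in NN; lia.
  have nn : (n0 <= N - l)%N by rewrite /N0 in NN; lia.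
  move: (N - l)%N nn => n nn {N NN}.
  have n1 : (1 < n)%N by apply: leq_trans nn.
  have jumps i := @glued_jumps R G h l n i pl n1 h0 (n0P n nn).
  have [mlow mhigh mass0] := glued_moments pl (ltnW n1) sl ml.
  have W i : (1 <= i < l + n)%N ->
      chord G (glued h l (l + n)) i <= chord G (glued h l (l + n)) i.+1 /\
      (chord G (glued h l (l + n)) i < chord G (glued h l (l + n)) i.+1) = (i \in I).
    move=> /andP[i1 iN]; have [J1 J2 J3 J4] := jumps i i1.
    rewrite !inE mem_iota i1 /=.
    have [il|li|il] := ltngtP i l.
    - have [il1|il1|il1] := ltngtP i l.-1.
      + have [-> ->] := J1 il1; rewrite hW ?i1 //; split=> //.
        by rewrite /= add1n ltnS (ltnW il).
      + by lia.
      + have := J2 il1; have := hW i; rewrite i1 il => /(_ isT) hi j.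
        have {}j : chord G (glued h l (l + n)) i < chord G (glued h l (l + n)) i.+1 by lra.
        by rewrite ltW // j; split=> //; lia.
    - by rewrite J4 // ltxx lexx; split=> //; lia.
    - by rewrite (ltW (J3 il)) (J3 il); split=> //; lia.
  split=> [|i /W[]//].
  apply: minimizer_of_moments => [i /W[]//|k kN|k /andP[k1 kN]||] //.
  - have [kl|/ltnW lk] := leqP k l; first by rewrite mlow ?hm.
    rewrite -(subnKC lk) mhigh; last by lia.
    have kn : (k - l)%:R <= n%:R :> R by rewrite ler_nat; lia.
    by rewrite divr_ge0 // !mulr_ge0 ?subr_ge0 // ?addr_ge0 ?ler0n.
  - have [J1 J2 J3 J4] := jumps k k1.
    (* Gluing alters only the corners at [l.-1] and [l], where the moment is 0; beyond [l] there are
       no corners. *)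
    have [kl|lk|->] := ltngtP k l.
    + rewrite mlow 1?ltnW //; have [kl1|lk1|->] := ltngtP k l.-1.
      * by have [-> ->] := J1 kl1; rewrite hslack // k1.
      * by lia.
      * by rewrite ml1 mul0r.
    + by rewrite J4 // subrr mulr0.
    + by rewrite mlow // ml mul0r.
  - by rewrite mhigh // subrr mulr0 mul0r.
have optE N i : (N0 <= N)%N -> (i <= N)%N ->
    entry (global_optimum R G N) i = glued h l N i.
  move=> NN iN; rewrite (global_optimum_eq (proj1 (main N NN))).
  by rewrite /entry mxE inordK.
exists N0, I; split.
- by rewrite /N0; lia.
- by apply/fset0Pn; exists l.
- move=> N NN; have [wmin wI] := main N NN.
  have Isub i : i \in I -> (1 <= i <= N - 1)%N.
    by rewrite !inE mem_iota; move: NN; rewrite /N0 /n0; lia.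
  split=> //; rewrite (global_optimum_eq wmin).
  have [wW _] := wmin; apply/(minimal_faceP wW Isub) => i iN.
  by rewrite !slope_row ?wI //; lia.
- rewrite maxI; split=> [N N' i NN NN' il|N i NN /andP[li iN]].
    by rewrite !optE ?/glued ?il //; move: NN NN'; rewrite /N0; lia.
  by rewrite optE // /glued ltnNge li.
Qed.
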